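(* Let $n\in\mathbb N$. (a) If $6\mid n$, then $$\sum_{k=0}^n\binom nk\binom{2k}{k}\frac{\left(\frac k3\right)}{4^k}=0.$$ (b) If $n\equiv3\pmod 6$, then $$\sum_{k=0}^n\binom nk\binom{2k}{k}\frac{3[3\mid k]-1}{4^k}=0.$$
   Context: $\left(\frac k3\right)$ is the Legendre symbol modulo $3$ (equal to $0$ if $3\mid k$, $1$ if $k\equiv1\pmod3$, $-1$ if $k\equiv2\pmod3$). $[3\mid k]$ equals $1$ if $3\mid k$ and $0$ otherwise. *)

(* Defs.v *)
From mathcomp Require Import all_boot all_order all_algebra.

Set Implicit Arguments.
Unset Strict Implicit.
Unset Printing Implicit Defensive.

Import GRing.Theory.
Local Open Scope ring_scope.

Definition legendre3 (k : nat) : int :=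
  if (k %% 3 == 0)%N then 0 else if (k %% 3 == 1)%N then 1 else -1.

Definition iverson (b : bool) : int := if b then 1 else 0.

(* Main.v *)
Require Import Defs.
From mathcomp Require Import all_boot all_order all_algebra all_field.
From mathcomp Require Import ring.

Set Implicit Arguments.
Unset Strict Implicit.
Unset Printing Implicit Defensive.

Import GRing.Theory Num.Theory.
Local Open Scope ring_scope.

(** Put [S_n(x) = \sum_k 'C(n, k) 'C(2k, k) (x / 4)^k].  Since
    [X + u (X + 1)^2 = (1 + 4 u) X + u (X - 1)^2], comparing the coefficients of
    [X^n] in the [n]-th powers of both sides, with [u = x / 4], gives
    [S_n(x) = (1 + x)^n S_n(- x / (1 + x))].  For a primitive cube root of unity
    [w] one has [1 + w = - w^2] and [- w / (1 + w) = w^2], so that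
    [S_n(w) = (- w^2)^n S_n(w^2)].  Hence [S_n(w) - S_n(w^2)], resp.
    [S_n(w) + S_n(w^2)], vanishes when [n] is [0], resp. [3], modulo [6]; and
    [w^k - w^(2k) = (k/3) (w - w^2)], [w^k + w^(2k) = 3 [3 | k] - 1]. *)

Lemma coef_XaddC_exp (R : comNzRingType) (e : R) (m k : nat) :
  (k <= m)%N -> (('X + e%:P) ^+ m)`_k = e ^+ (m - k) *+ 'C(m, k).
Proof.
(* The swap makes the index of the binomial sum the exponent of ['X]. *)
move=> le_km; rewrite addrC exprDn coef_sum.
rewrite (bigD1 (inord k)) //= inordK // big1 => [|i ne_ik].
  by rewrite addr0 coefMn -polyC_exp coefCM coefXn eqxx mulr1.
rewrite coefMn -polyC_exp coefCM coefXn; case: eqP => [eq_ki|_].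
  by case/eqP: ne_ik; apply: val_inj; rewrite /= inordK.
by rewrite mulr0 mul0rn.
Qed.

(** In the binomial expansion the [k]-th term carries ['X^(n - k)] times [('X + e)^(2k)], so it
    contributes the middle coefficient ['C(2k, k) e^k] of the latter. *)
Lemma coef_quadratic_exp (R : comNzRingType) (c u e : R) (n : nat) :
  ((c *: 'X + u *: ('X + e%:P) ^+ 2) ^+ n)`_n =
  \sum_(k < n.+1) c ^+ (n - k) * (u * e) ^+ k * ('C(n, k) * 'C(2 * k, k))%:R.
Proof.
rewrite exprDn coef_sum; apply: eq_bigr => k _.
have le_kn : (k <= n)%N by rewrite -ltnS.
rewrite coefMn !exprZn -scalerAl -scalerAr !coefZ coefXnM.
rewrite ltnNge leq_subr /= subKn // -exprM coef_XaddC_exp; last first.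
  by rewrite mulSn leq_addr.
rewrite mulSn mul1n addnK exprMn natrM -[in LHS]mulr_natr -[in LHS]mulr_natr.
by ring.
Qed.

Lemma sum_bin_central_bin_reflect (R : comNzRingType) (u : R) (n : nat) :
  \sum_(k < n.+1) u ^+ k * ('C(n, k) * 'C(2 * k, k))%:R =
  \sum_(k < n.+1) (1 + 4 * u) ^+ (n - k) * (- u) ^+ k
                  * ('C(n, k) * 'C(2 * k, k))%:R.
Proof.
have eq_quad : 1 *: 'X + u *: ('X + 1%:P) ^+ 2 =
               (1 + 4 * u) *: 'X + u *: ('X + (-1)%:P) ^+ 2 :> {poly R}.
  by rewrite -!mul_polyC !(polyCD, polyCM, polyCN); ring.
(* The two sides are [coef_quadratic_exp] with [(c, e)] equal to [(1, 1)] and [(1 + 4u, -1)]. *)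
have := congr1 (fun p : {poly R} => (p ^+ n)`_n) eq_quad.
rewrite /= !coef_quadratic_exp mulr1 mulrN1 => <-.
by apply: eq_bigr => k _; rewrite expr1n mul1r.
Qed.

Definition bin_central_bin_poly {F : fieldType} (n : nat) (x : F) : F :=
  \sum_(k < n.+1) (x / 4) ^+ k * ('C(n, k) * 'C(2 * k, k))%:R.

Section CubeRoot.

Variables (F : numFieldType) (w : F).
Hypothesis w_root : w ^+ 2 + w + 1 = 0.

Let w3 : w ^+ 3 = 1.
Proof.
apply/eqP; rewrite -subr_eq0; apply/eqP.
transitivity ((w - 1) * (w ^+ 2 + w + 1)); first by ring.
by rewrite w_root mulr0.
Qed.

Let w_sqr : w ^+ 2 = - w - 1.
Proof. by apply/eqP; rewrite -subr_eq0 -w_root; apply/eqP; ring. Qed.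

Let expw_mod3 (k : nat) : w ^+ k = w ^+ (k %% 3).
Proof. by rewrite expr_mod. Qed.

Lemma bin_central_bin_poly_cube_root (n : nat) :
  bin_central_bin_poly n w = (- w ^+ 2) ^+ n * bin_central_bin_poly n (w ^+ 2).
Proof.
rewrite /bin_central_bin_poly sum_bin_central_bin_reflect mulr_sumr.
apply: eq_bigr => k _; rewrite [RHS]mulrA; congr (_ * _).
have le_kn : (k <= n)%N by rewrite -ltnS.
have nz4 : (4 : F) != 0 by rewrite pnatr_eq0.
have -> : 1 + 4 * (w / 4) = - w ^+ 2 by rewrite w_sqr; field.
(* Since [w^4 = w], each [k]-th power releases a factor [(- w^2)^k], which completes
   [(- w^2)^(n - k)] to [(- w^2)^n]. *)
have -> : - (w / 4) = - w ^+ 2 * (w ^+ 2 / 4).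
  by rewrite mulrA mulNr -exprD (exprS w 3) w3 mulr1 mulNr.
by rewrite exprMn mulrA -exprD subnK.
Qed.

Lemma legendre3_cube_root (k : nat) :
  w ^+ k - (w ^+ 2) ^+ k = (legendre3 k)%:~R * (w - w ^+ 2).
Proof.
(* Writing [(w^2)^k] as [(w^k)^2] lets one reduction modulo 3 act on both powers. *)
rewrite -exprM mulnC exprM expw_mod3 /legendre3.
have := ltn_pmod k (isT : 0 < 3)%N.
case: (k %% 3)%N => [|[|[|//]]] _ /=.
- by rewrite expr1n subrr mul0r.
- by rewrite mul1r expr1.
- by rewrite -exprM (exprS w 3) w3; ring.
Qed.

Lemma iverson3_cube_root (k : nat) :
  w ^+ k + (w ^+ 2) ^+ k = (3 * iverson (3 %| k)%N - 1)%:~R.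
Proof.
rewrite -exprM mulnC exprM expw_mod3 /iverson /dvdn.
have := ltn_pmod k (isT : 0 < 3)%N.
case: (k %% 3)%N => [|[|[|//]]] _ /=.
- by rewrite expr1n expr0; ring.
- by rewrite expr1 w_sqr; ring.
- by rewrite -exprM (exprS w 3) w3 w_sqr; ring.
Qed.

Lemma sum_legendre3_cube_root (n : nat) :
  \sum_(0 <= k < n.+1)
     ('C(n, k)%:R * 'C(2 * k, k)%:R * ((legendre3 k)%:~R / 4 ^+ k))
    * (w - w ^+ 2)
  = bin_central_bin_poly n w - bin_central_bin_poly n (w ^+ 2).
Proof.
rewrite /bin_central_bin_poly -sumrB big_mkord; apply: eq_bigr => k _.
rewrite -mulrBl !expr_div_n -mulrBl legendre3_cube_root natrM.
by ring.
Qed.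

Lemma sum_iverson3_cube_root (n : nat) :
  \sum_(0 <= k < n.+1)
     ('C(n, k)%:R * 'C(2 * k, k)%:R
        * ((3 * iverson (3 %| k)%N - 1)%:~R / 4 ^+ k))
  = bin_central_bin_poly n w + bin_central_bin_poly n (w ^+ 2).
Proof.
rewrite /bin_central_bin_poly -big_split big_mkord; apply: eq_bigr => k _ /=.
rewrite -mulrDl !expr_div_n -mulrDl iverson3_cube_root natrM.
by ring.
Qed.

(** The square is -3, nonzero in characteristic 0. This allows the factor in
    [sum_legendre3_cube_root] to be cancelled. *)
Lemma cube_root_neq_sqr : w - w ^+ 2 != 0.
Proof.
apply/eqP => eq_ww2.
have : (w - w ^+ 2) ^+ 2 = -3.
  transitivity (w ^+ 2 - 2 * w ^+ 3 + w ^+ 3 * w); first by ring.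
  by rewrite w3 w_sqr; ring.
by rewrite eq_ww2 expr0n /= => /eqP; rewrite eq_sym oppr_eq0 pnatr_eq0.
Qed.

(** As [w^3 = 1], only the sign survives, so the parity of [n] decides between the two cases of the
    theorem. *)
Lemma exp_opp_sqr_cube_root (n : nat) :
  (3 %| n)%N -> (- w ^+ 2) ^+ n = (-1) ^+ n.
Proof.
case/dvdnP=> m ->.
by rewrite (exprNn (w ^+ 2)) -exprM mulnA (mulnC (2 * m)%N)
           (exprM w) w3 expr1n mulr1.
Qed.

End CubeRoot.

Lemma algC_cube_root : exists w : algC, w ^+ 2 + w + 1 = 0.
Proof.
have [w w_prim] := C_prim_root_exists (isT : 0 < 3)%N.
exists w; have /eqP := prim_expr_order w_prim.
have -> : (w ^+ 3 == 1) = ((w - 1) * (w ^+ 2 + w + 1) == 0).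
  by rewrite -subr_eq0; congr (_ == 0); ring.
rewrite mulf_eq0 subr_eq0 => /orP[/eqP w1|/eqP //].
(* If [w = 1], the order 3 would divide 1. *)
by have := prim_order_dvd w_prim 1; rewrite w1 expr1n eqxx.
Qed.

Theorem theorem1p4 (n : nat) :
  ((6 %| n)%N ->
     \sum_(0 <= k < n.+1)
        ('C(n, k)%:R * 'C(2 * k, k)%:R * ((legendre3 k)%:~R / 4 ^+ k)) = 0 :> rat)
  /\
  ((n = 3 %[mod 6])%N ->
     \sum_(0 <= k < n.+1)
        ('C(n, k)%:R * 'C(2 * k, k)%:R
           * ((3 * iverson (3 %| k)%N - 1)%:~R / 4 ^+ k)) = 0 :> rat).
Proof.
have [w w_root] := algC_cube_root.
(* The sums are rational but [w] lies in [algC], so both equalities are carried there along an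
   injective morphism. *)
have ratr_inj : injective (ratr : rat -> algC) by exact: fmorph_inj.
split=> n6; apply: ratr_inj; rewrite rmorph0 rmorph_sum /=.
- have n3 : (3 %| n)%N by apply: dvdn_trans n6.
  have /negbTE n_even : ~~ odd n by rewrite -dvdn2; apply: dvdn_trans n6.
  apply: (mulIf (cube_root_neq_sqr w_root)); rewrite mul0r mulr_suml.
  transitivity (bin_central_bin_poly n w - bin_central_bin_poly n (w ^+ 2)).
    rewrite -sum_legendre3_cube_root //; apply: eq_bigr => k _.
    by rewrite !rmorphM fmorphV rmorphXn /= !ratr_nat ratr_int.
  rewrite bin_central_bin_poly_cube_root // exp_opp_sqr_cube_root //.
  by rewrite -signr_odd n_even mul1r subrr.
- have n3 : (3 %| n)%N by rewrite (divn_eq n 6) n6 dvdn_add // dvdn_mull.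
  have n_odd : odd n by rewrite (divn_eq n 6) n6 oddD oddM andbF.
  transitivity (bin_central_bin_poly n w + bin_central_bin_poly n (w ^+ 2)).
    rewrite -sum_iverson3_cube_root //; apply: eq_bigr => k _.
    by rewrite !rmorphM fmorphV rmorphXn /= !ratr_nat ratr_int.
  rewrite bin_central_bin_poly_cube_root // exp_opp_sqr_cube_root //.
  by rewrite -signr_odd n_odd mulN1r addNr.
Qed.
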